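(* Let $U=\{u_1,u_2\}$ be a two-element set, with its two partitions $C=\{\{u_1,u_2\}\}$ and $D=\{\{u_1\},\{u_2\}\}$. In the order $(C,D)$, $$T_2(t)=\begin{pmatrix}t&t\\t&t^2\end{pmatrix}.$$
   Context: For a finite set $U$ with $n$ elements, let $\Pi(U)=\{\pi_1,\ldots,\pi_m\}$ be the set of its set partitions, in a chosen order. For $\pi,\sigma\in\Pi(U)$, $\rho(\pi,\sigma)$ is the number of blocks of the smallest equivalence relation on $U$ containing the equivalence relations represented by both $\pi$ and $\sigma$. The splitting matrix is $T_n(t)=\bigl(t^{\rho(\pi_i,\pi_j)}\bigr)_{i,j}$. *)

(* Defs.v *)
From HB Require Import structures.
From mathcomp Require Import all_boot all_order all_algebra.
Set Implicit Arguments. Unset Strict Implicit. Unset Printing Implicit Defensive.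
Import GRing.Theory.
Local Open Scope ring_scope.

Definition set_partitions (U : finType) : {set {set {set U}}} :=
  [set P | partition P [set: U]].

(* Binary relations on U are represented by their graphs in U * U, so that the
   intersection of all relations with a given property is a finite bigcap. *)
Definition equivalence_graph (U : finType) (E : {set U * U}) : bool :=
  [&& [forall x, (x, x) \in E],
      [forall x, forall y, ((x, y) \in E) ==> ((y, x) \in E)] &
      [forall x, forall y, forall z,
         ((x, y) \in E) ==> ((y, z) \in E) ==> ((x, z) \in E)]].

Definition partition_graph (U : finType) (P : {set {set U}}) : {set U * U} :=
  [set p | [exists B in P, (p.1 \in B) && (p.2 \in B)]].

Definition join_graph (U : finType) (P Q : {set {set U}}) : {set U * U} :=
  \bigcap_(E : {set U * U} | [&& equivalence_graph E,
             partition_graph P \subset E & partition_graph Q \subset E]) E.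

Definition rho (U : finType) (P Q : {set {set U}}) : nat :=
  #|equivalence_partition (fun x y => (x, y) \in join_graph P Q) [set: U]|.

Definition partition_order (U : finType) (m : nat)
    (s : m.-tuple {set {set U}}) : Prop :=
  uniq s /\ s =i set_partitions U.

(* The entries are the partitions listed by s; this is T_n(t), with n = #|U|,
   when s satisfies partition_order. *)
Definition splitting_mx (R : comNzRingType) (U : finType) (m : nat)
    (s : m.-tuple {set {set U}}) (t : R) : 'M[R]_m :=
  \matrix_(i < m, j < m) t ^+ rho (tnth s i) (tnth s j).

Lemma equivalence_graphP (U : finType) (E : {set U * U}) :
  reflect (equivalence_rel (fun x y => (x, y) \in E)) (equivalence_graph E).
Proof.
apply: (iffP and3P) => [[/forallP Er Es Et]|/equivalence_relP[Er Et]].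
  have sym x y : (x, y) \in E -> (y, x) \in E.
    exact/implyP/(forallP (forallP Es x)).
  have trans x y z : (x, y) \in E -> (y, z) \in E -> (x, z) \in E.
    by move=> Exy; apply/implyP; move: Exy; apply/implyP;
       apply: (forallP (forallP (forallP Et x) y)).
  apply/equivalence_relP; split=> // x y Exy z.
  by apply/idP/idP; apply: trans => //; apply: sym.
have sym x y : (x, y) \in E -> (y, x) \in E by move=> /Et <-; apply: Er.
split.
- exact/forallP.
- by apply/forallP=> x; apply/forallP=> y; apply/implyP; apply: sym.
- apply/forallP=> x; apply/forallP=> y; apply/forallP=> z.
  by apply/implyP=> Exy; apply/implyP; rewrite (Et _ _ Exy).
Qed.

Lemma join_graph_equivalence (U : finType) (P Q : {set {set U}}) :
  equivalence_rel (fun x y => (x, y) \in join_graph P Q).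
Proof.
apply/equivalence_relP; split=> [x|x y /bigcapP Exy z].
  by apply/bigcapP=> E /and3P[/equivalence_graphP/equivalence_relP[]].
by apply/bigcapP/bigcapP=> h E hE; move: (h E hE) (Exy E hE);
   have /and3P[/equivalence_graphP/equivalence_relP[_ Et] _ _] := hE;
   move=> Ez /Et Exyz; rewrite ?Exyz // -?Exyz.
Qed.

Lemma partition_graph_subl (U : finType) (P Q : {set {set U}}) :
  partition_graph P \subset join_graph P Q.
Proof. by apply/bigcapsP=> E /and3P[]. Qed.

Lemma partition_graph_subr (U : finType) (P Q : {set {set U}}) :
  partition_graph Q \subset join_graph P Q.
Proof. by apply/bigcapsP=> E /and3P[]. Qed.

Lemma join_graph_min (U : finType) (P Q : {set {set U}}) (E : {set U * U}) :
  equivalence_rel (fun x y => (x, y) \in E) ->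
  partition_graph P \subset E -> partition_graph Q \subset E ->
  join_graph P Q \subset E.
Proof.
by move=> /equivalence_graphP eqE sP sQ; apply: bigcap_inf; rewrite eqE sP.
Qed.

(* Main.v *)
Require Import Defs.
From mathcomp Require Import all_boot all_order all_algebra.
Local Open Scope ring_scope.

(** A partition is the image of its ground set under the map sending a point to
    its block, so a partition of [{u1, u2}] is determined by whether the block
    of [u1] contains [u2]: it is [C] if so and [D] otherwise.

    Each entry of the matrix is an instance of a general fact on joins of
    partitions.  The one-block partition is the top of the partition lattice, so
    its join with anything has a single block ([rho_setT]); this and the symmetry
    of the join ([rhoC]) give the three entries [t].  The join is idempotent, so
    the exponent at [(D, D)] is the number of blocks of [D] ([rho_id]). *)

Lemma rhoC {U : finType} (P Q : {set {set U}}) : rho P Q = rho Q P.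
Proof.
rewrite /rho (_ : join_graph P Q = join_graph Q P) //.
by apply: eq_bigl => E; rewrite [X in _ && X]andbC.
Qed.

(** The ground set is taken inhabited because the join relation on an empty set
    has no class at all. *)
Lemma rho_setT {U : finType} {P : {set {set U}}} (Q : {set {set U}}) (u : U) :
  [set: U] \in P -> rho P Q = 1%N.
Proof.
move=> PT; have joinT x y : (x, y) \in join_graph P Q.
  apply/(subsetP (partition_graph_subl P Q)); rewrite inE.
  by apply/existsP; exists [set: U]; rewrite PT !inE.
rewrite /rho -(cards1 [set: U]); congr #|pred_of_set _|; apply/setP=> B.
rewrite inE; apply/imsetP/eqP => [[x _ ->]|->]; last exists u => //;
  by apply/setP=> y; rewrite !inE joinT.
Qed.

(** Disjointness of the blocks makes [pblock P x] the only block that can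
    witness a pair with first component [x]. *)
Lemma mem_partition_graph {U : finType} {P : {set {set U}}} (x y : U) :
  partition P [set: U] -> ((x, y) \in partition_graph P) = (y \in pblock P x).
Proof.
case/and3P=> /eqP covP tiP _; rewrite inE /=; apply/existsP/idP.
  by case=> B /and3P[PB xB yB]; rewrite (def_pblock tiP PB xB).
by move=> yPx; exists (pblock P x); rewrite pblock_mem ?mem_pblock ?covP ?inE.
Qed.

(** The graph of a partition is already an equivalence relation, hence the least
    one containing itself, and its classes are the blocks. *)
Lemma rho_id {U : finType} {P : {set {set U}}} :
  partition P [set: U] -> rho P P = #|P|.
Proof.
move=> partP; have /and3P[/eqP covP tiP _] := partP.
have eqvP : equivalence_rel (fun x y => (x, y) \in partition_graph P).
  move=> x y z; rewrite /= !mem_partition_graph // mem_pblock covP inE.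
  by split=> // /(same_pblock tiP) ->.
have joinPP : join_graph P P = partition_graph P.
  by apply/eqP; rewrite eqEsubset partition_graph_subl join_graph_min.
rewrite /rho joinPP -[in RHS](equivalence_partition_pblock partP).
congr #|pred_of_set _|; apply: eq_imset => x; apply/setP=> y.
by rewrite [LHS]inE [RHS]inE mem_partition_graph ?inE.
Qed.

Lemma partition_setT {U : finType} (u : U) : partition [set [set: U]] [set: U].
Proof.
rewrite /partition /trivIset /cover !big_set1 !eqxx inE eq_sym /=.
by apply/set0Pn; exists u.
Qed.

Lemma partition_imset_pblock {U : finType} {P : {set {set U}}} {A : {set U}} :
  partition P A -> P = [set pblock P x | x in A].
Proof.
move=> partP; rewrite -{1}(equivalence_partition_pblock partP).
apply: eq_in_imset => x Ax; apply/setP=> y; rewrite inE andb_idl // => yPx.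
rewrite -(cover_partition partP); apply/bigcupP; exists (pblock P x) => //.
by rewrite pblock_mem // (cover_partition partP).
Qed.

Lemma partition_set1s {U : finType} {u1 u2 : U} :
  u1 != u2 -> partition [set [set u1]; [set u2]] [set u1; u2].
Proof.
move=> u12; have s12 : [set u1] != [set u2] by rewrite (inj_eq set1_inj).
rewrite /partition /trivIset /cover !big_setU1 ?inE //= !big_set1 !cards1.
by rewrite eqxx cards2 u12 ![set0 == _]eq_sym -!cards_eq0 !cards1.
Qed.

(** Blocks being disjoint, [u2] lies in the block of [u1] exactly when [u1] lies
    in the block of [u2]; so one membership test settles both blocks. *)
Lemma set_partitions_two {U : finType} {u1 u2 : U} :
  u1 != u2 -> [set: U] = [set u1; u2] ->
  set_partitions U = [set [set [set u1; u2]]; [set [set u1]; [set u2]]].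
Proof.
move=> u12 defU; apply/setP=> P; rewrite !inE; apply/idP/orP; last first.
  case=> /eqP->; last by rewrite defU; apply: partition_set1s.
  by rewrite -defU; apply: partition_setT u1.
move=> partP; have /and3P[/eqP covP tiP _] := partP.
have memU x : x \in pblock P x by rewrite mem_pblock covP inE.
have defP : P = [set pblock P u1; pblock P u2].
  by rewrite [LHS](partition_imset_pblock partP) defU imsetU1 imset_set1.
have two y : (y == u1) || (y == u2) by have := in_setT y; rewrite defU !inE.
have [u2P1 | u2P1] := boolP (u2 \in pblock P u1); [left | right]; apply/eqP.
  rewrite defP (same_pblock tiP u2P1) setUid; congr [set _].
  by apply/setP=> y; rewrite !inE two; case/orP: (two y) => /eqP->; rewrite ?memU.
have u1P2 : u1 \notin pblock P u2.
  by apply: contra u2P1 => /(same_pblock tiP) ->.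
rewrite defP; congr [set _; _]; apply/setP=> y; rewrite inE;
  case/orP: (two y) => /eqP->; rewrite ?eqxx ?memU //.
- by rewrite (negPf u2P1) eq_sym (negPf u12).
- by rewrite (negPf u1P2) (negPf u12).
Qed.

Theorem proposition6p1 (R : comNzRingType) (t : R) (U : finType) (u1 u2 : U)
    (u12 : u1 != u2) (defU : [set: U] = [set u1; u2]) :
  let C : {set {set U}} := [set [set u1; u2]] in
  let D : {set {set U}} := [set [set u1]; [set u2]] in
  partition_order [tuple C; D] /\
  splitting_mx [tuple C; D] t =
    \matrix_(i < 2, j < 2) nth 0 (nth [::] [:: [:: t; t];
                                               [:: t; t ^+ 2]] i) j.
Proof.
move=> C D; have cardD : #|D| = 2 by rewrite cards2 (inj_eq set1_inj) u12.
have defPi : set_partitions U = [set C; D] by apply: set_partitions_two.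
have rhoCl Q : rho C Q = 1%N by rewrite (rho_setT _ u1) // defU set11.
have partD : partition D [set: U].
  have : D \in set_partitions U by rewrite defPi set22.
  by rewrite inE.
split.
  split=> [|P]; last by rewrite defPi !inE.
  rewrite /= inE andbT; apply/eqP=> eqCD.
  by move: cardD; rewrite -eqCD cards1.
apply/matrixP=> i j; rewrite !mxE !(tnth_nth C).
case: i j => [[|[|//]] ?] [[|[|//]] ?] /=.
- by rewrite rhoCl.
- by rewrite rhoCl.
- by rewrite rhoC rhoCl.
- by rewrite rho_id // cardD.
Qed.
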